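(* Let $s$ and $q$ be positive integers with $s = q - 4$ and $s \equiv 3 \pmod 4$. If there exists a skew Hadamard matrix of order $s+1$ and there exists a conference matrix of order $q$, then there exists a Hadamard matrix of order $2q(s+1)$.
   Context: A Hadamard matrix of order $n$ is an $n\times n$ matrix $H$ with entries in $\{-1,1\}$ such that $HH^T = H^TH = nI_n$. A skew Hadamard matrix is a Hadamard matrix $H$ of the form $H = S + I$ with $S$ skew-symmetric ($S^T=-S$). Write $J_q$ for the $q\times q$ all-ones matrix. In this paper a conference matrix of order $q$ means a $q\times q$ matrix $C_q$ with zero diagonal, entries $\pm 1$ off the diagonal, satisfying $C_qC_q^T = qI_q - J_q$ and $C_qJ_q = J_qC_q = 0$ (for example, for a prime power $q$, the matrix $C_q=[\chi(\alpha_j-\alpha_i)]_{i,j}$ where $\chi$ is the quadratic character of $GF(q)=\{\alpha_1,\dots,\alpha_q\}$ with $\chi(0)=0$). *)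

(* Defs.v *)
From mathcomp Require Export all_boot all_order all_algebra.

Set Implicit Arguments.
Unset Strict Implicit.
Unset Printing Implicit Defensive.

Import GRing.Theory.
Local Open Scope ring_scope.

Definition hadamard (n : nat) (H : 'M[int]_n) : Prop :=
  [/\ forall i j, H i j = 1 \/ H i j = -1,
      H *m H^T = (n%:R)%:M
    & H^T *m H = (n%:R)%:M].

Definition skew_hadamard (n : nat) (H : 'M[int]_n) : Prop :=
  hadamard H /\ exists S : 'M[int]_n, S^T = - S /\ H = S + 1%:M.

Definition all_ones (q : nat) : 'M[int]_q := const_mx 1.

(* The order-q normalisation C C^T = q I - J, C J = J C = 0, i.e. the core of
   what is elsewhere called a conference matrix of order q + 1. *)
Definition conference (q : nat) (C : 'M[int]_q) : Prop :=
  [/\ forall i, C i i = 0,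
      forall i j, i != j -> C i j = 1 \/ C i j = -1,
      C *m C^T = (q%:R)%:M - all_ones q,
      C *m all_ones q = 0
    & all_ones q *m C = 0].

(* Main.v *)
Require Import Defs.
From mathcomp Require Import all_boot all_order all_algebra.
From mathcomp Require Import mxtens zify ring.

(** Let [S = H - I] be the skew part of the given skew Hadamard matrix of order
    [n = s + 1], so [S S^T = s I], and let [A = J - 2I].  With [q = s + 4],
      [A A^T = 4I + s J]  and
      [(C + I)(C + I)^T + (C - I)(C - I)^T = 2((q + 1) I - J)],
    so the [J]-terms cancel in [2 A A^T + s (...) = 2 q n I].  Hence the
    [+-1]-matrices [X = A (x) I + (C + I) (x) S] and
    [Y = - A (x) I + (C - I) (x) S] satisfy [X X^T + Y Y^T = 2 q n I]: the terms
    in [S] cancel because [(C + I) - (C - I)] is the scalar matrix [2I].  Since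
    [C] is normal and commutes with [J], the matrices [X, Y, X^T, Y^T] commute,
    and [[X, Y], [-Y^T, X^T]] is Hadamard. *)

Set Implicit Arguments.
Unset Strict Implicit.
Unset Printing Implicit Defensive.

Import GRing.Theory Num.Theory.

Section SkewPencils.
Local Open Scope ring_scope.

Lemma mulmx_scalar_comm (R : idomainType) n (c : R) (A B : 'M[R]_n) :
  c != 0 -> A *m B = c%:M -> B *m A = c%:M.
Proof.
move=> c0 AB.
have detA0 : \det A != 0.
  apply: contra_neq (expf_neq0 n c0) => A0.
  by rewrite -det_scalar -AB det_mulmx A0 mul0r.
have : \det A *: (B *m A - c%:M) = 0.
  rewrite -mul_scalar_mx -mul_adj_mx -mulmxA mulmxBr mulmxA AB.
  by rewrite scalar_mxC subrr mulmx0.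
move/eqP; rewrite scalemx_eq0 (negPf detA0) /= subr_eq0.
by move/eqP.
Qed.

Lemma comm_mx_addscalar (R : comPzRingType) n (M N : 'M[R]_n) a b :
  comm_mx M N -> comm_mx (M + a%:M) (N + b%:M).
Proof.
rewrite /comm_mx !mulmxDl !mulmxDr => ->.
rewrite [M *m _]scalar_mxC [N *m a%:M]scalar_mxC [a%:M *m b%:M]scalar_mxC.
by rewrite addrACA.
Qed.

Lemma tensmxDl (R : pzRingType) m n p r (A B : 'M[R]_(m, n)) (D : 'M[R]_(p, r)) :
  (A + B) *t D = A *t D + B *t D.
Proof. by apply/matrixP=> i j; rewrite !mxE mulrDl. Qed.

Lemma tensmxNr (R : pzRingType) m n p r (A : 'M[R]_(m, n)) (D : 'M[R]_(p, r)) :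
  A *t (- D) = (- A) *t D.
Proof. by apply/matrixP=> i j; rewrite !mxE mulrN mulNr. Qed.

Lemma tensmxZr (R : comPzRingType) m n p r (c : R) (A : 'M[R]_(m, n))
  (D : 'M[R]_(p, r)) : A *t (c *: D) = (c *: A) *t D.
Proof. by apply/matrixP=> i j; rewrite !mxE mulrCA mulrA. Qed.

Lemma tens_scalar_1 (R : pzRingType) m n (c : R) :
  c%:M *t 1%:M = c%:M :> 'M[R]_(m * n).
Proof.
apply/matrixP=> k l; case: (mxtens_indexP k) => i j.
case: (mxtens_indexP l) => i' j'; rewrite tensmxE !mxE.
rewrite (can_eq (@mxtens_indexK m n)) xpair_eqE.
by case: (i == i'); case: (j == j'); rewrite ?(mul0r, mulr0, mulr1).
Qed.

(** When [S *m S = t%:M], pencils multiply like [A + B sqrt(t)] with matrix coefficients, and for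
    skew [S] transposition also conjugates [sqrt(t)]. Computations thus reduce to the coefficients
    of order [q]. *)
Definition pencil q n (S : 'M[int]_n) (A B : 'M[int]_q) : 'M[int]_(q * n) :=
  A *t 1%:M + B *t S.

Section Pencil.
Variables (q n : nat) (S : 'M[int]_n).
Implicit Types A B : 'M[int]_q.

Lemma pencilD A B A' B' :
  pencil S A B + pencil S A' B' = pencil S (A + A') (B + B').
Proof. by rewrite /pencil !tensmxDl addrACA. Qed.

Lemma pencil_scalar c : pencil S (c%:M : 'M_q) 0 = c%:M.
Proof. by rewrite /pencil tens0mx addr0 tens_scalar_1. Qed.

Lemma pencil_tr A B : S^T = - S -> (pencil S A B)^T = pencil S A^T (- B^T).
Proof.
by move=> skS; rewrite /pencil linearD /= !trmx_tens skS tensmxNr trmx1.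
Qed.

Lemma pencil_mul t A B A' B' : S *m S = t%:M ->
  pencil S A B *m pencil S A' B'
  = pencil S (A *m A' + t *: (B *m B')) (A *m B' + B *m A').
Proof.
move=> SS; rewrite /pencil mulmxDl !mulmxDr !tensmx_mul !mul1mx !mulmx1 SS.
rewrite -[t%:M]scalemx1 tensmxZr !tensmxDl.
by rewrite [X in _ + X = _]addrC addrACA.
Qed.

Lemma pencil_comm t A B A' B' : S *m S = t%:M ->
  comm_mx A A' -> comm_mx A B' -> comm_mx B A' -> comm_mx B B' ->
  comm_mx (pencil S A B) (pencil S A' B').
Proof.
rewrite /comm_mx => SS AA AB BA BB; rewrite !(pencil_mul _ _ _ _ SS).
by rewrite AA AB BA BB [X in pencil S _ X]addrC.
Qed.

(* The supports of [A (x) I] and [B (x) S] are complementary. *)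
Lemma pencil_pm1 A B :
  (forall i, S i i = 0) -> (forall i j, i != j -> S i j = 1 \/ S i j = -1) ->
  (forall i j, A i j = 1 \/ A i j = -1) ->
  (forall i j, B i j = 1 \/ B i j = -1) ->
  forall i j, pencil S A B i j = 1 \/ pencil S A B i j = -1.
Proof.
move=> S0 S1 A1 B1 k l; case: (mxtens_indexP k) => i j.
case: (mxtens_indexP l) => i' j'; rewrite mxE !tensmxE mxE.
case: eqVneq => [<-|/S1 Sj]; first by rewrite S0 mulr0 addr0 mulr1.
rewrite mulr0 add0r.
by case: Sj => ->; case: (B1 i i') => ->; [left|right|right|left].
Qed.

End Pencil.

Lemma hadamard_of_rows n (H : 'M[int]_n) :
  (forall i j, H i j = 1 \/ H i j = -1) -> H *m H^T = n%:R%:M -> hadamard H.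
Proof.
(* Order 0 is split off: there the scalar [n%:R] vanishes and cannot be cancelled. *)
move=> H1 HH; split=> //; case: n H H1 HH => [|n] H _ HH.
  by apply/matrixP=> -[].
by apply: mulmx_scalar_comm HH; rewrite pnatr_eq0.
Qed.

(** In the Gram matrix of the rows, the off-diagonal blocks are [Y X - X Y] and its transpose;
    normality turns the lower diagonal block [Y^T Y + X^T X] into the upper one. *)
Lemma hadamard_of_commuting_pair n (X Y : 'M[int]_n) :
  (forall i j, X i j = 1 \/ X i j = -1) ->
  (forall i j, Y i j = 1 \/ Y i j = -1) ->
  comm_mx X Y -> comm_mx X X^T -> comm_mx Y Y^T ->
  X *m X^T + Y *m Y^T = (n + n)%:R%:M ->
  hadamard (block_mx X Y (- Y^T) X^T).
Proof.
move=> X1 Y1 XY XX YY sumXY; apply: hadamard_of_rows => [i j|].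
  case: (split_ordP i) => i' ->; case: (split_ordP j) => j' ->.
  - by rewrite block_mxEul.
  - by rewrite block_mxEur.
  - rewrite block_mxEdl !mxE.
    by case: (Y1 j' i') => ->; [right|left; rewrite opprK].
  - by rewrite block_mxEdr mxE.
rewrite tr_block_mx !linearN /= !trmxK mulmx_block scalar_mx_block sumXY.
rewrite !mulmxN !mulNmx opprK XY addNr -!trmx_mul XY addNr.
by rewrite -YY -XX [in X in block_mx _ _ _ X]addrC sumXY.
Qed.

Lemma all_ones_sqr q : all_ones q *m all_ones q = q%:R *: all_ones q.
Proof.
apply/matrixP=> i j; rewrite !mxE.
under eq_bigr do rewrite !mxE mulr1.
by rewrite sumr_const card_ord mulr1.
Qed.

(** [C] is singular since it kills [J], but [C + J] is not. Its right inverse is also a left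
    inverse, which forces [C^T C = q I - J = C C^T]. *)
Lemma conference_normal q (C : 'M[int]_q) :
  (0 < q)%N -> conference C -> comm_mx C C^T.
Proof.
move=> q0 [_ _ CC CJ JC].
have JT : (all_ones q)^T = all_ones q by rewrite /all_ones trmx_const.
have JJ := all_ones_sqr q.
have CtJ : C^T *m all_ones q = 0 by rewrite -JT -trmx_mul JC trmx0.
have JCt : all_ones q *m C^T = 0 by rewrite -JT -trmx_mul CJ trmx0.
(* [C + J] has inverse [q^-2 (q C^T + J)]. *)
have CJinv : (C + all_ones q) *m (q%:R *: C^T + all_ones q) = (q%:R * q%:R)%:M.
  rewrite mulmxDl !mulmxDr -!scalemxAr CJ JCt JJ CC scaler0 add0r addr0.
  by rewrite -scalerDr subrK -scalemx1 scalerA scalemx1.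
have /mulmx_scalar_comm/(_ CJinv) : (q%:R * q%:R : int) != 0.
  by rewrite mulf_neq0 // pnatr_eq0 -lt0n.
rewrite mulmxDl !mulmxDr -!scalemxAl CtJ JC JJ scaler0 add0r addr0.
rewrite -scalerDr -scalemx1 -scalerA scalemx1 => /eqP.
rewrite -subr_eq0 -scalerBr scalemx_eq0 pnatr_eq0 -leqn0 leqNgt q0 /=.
by rewrite subr_eq0 => /eqP CtC; rewrite /comm_mx CC -CtC addrK.
Qed.

Lemma hadamard_of_skew_conference s q (S : 'M[int]_(s + 1)) (C : 'M[int]_q) :
  q = (s + 4)%N -> hadamard (S + 1%:M) -> S^T = - S -> conference C ->
  exists H : 'M[int]_(q * (s + 1) + q * (s + 1)), hadamard H.
Proof.
move=> qE [H1 HH _] skS confC.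
have q0 : (0 < q)%N by rewrite qE addn4.
have qR : q%:R = s%:R + 4 :> int by rewrite qE natrD.
have normC := conference_normal q0 confC.
case: confC => C0 C1 CC CJ JC.
set J := all_ones q in CC CJ JC.
have JT : J^T = J by rewrite /J /all_ones trmx_const.
have JJ : J *m J = q%:R *: J by exact: all_ones_sqr.
have S0 i : S i i = 0.
  by move/matrixP/(_ i i): skS; rewrite !mxE; move: (S i i) => x; lia.
have S1 i j : i != j -> S i j = 1 \/ S i j = -1.
  by move=> /negPf ij; have := H1 i j; rewrite !mxE ij addr0.
(* Skewness turns the Hadamard identity into [(S + I)(I - S) = I - S^2 = (s + 1) I]. *)
have SS : S *m S = (- s%:R)%:M.
  move: HH; rewrite linearD /= skS trmx1 mulmxDl !mulmxDr mulmxN !mul1mx mulmx1.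
  move: (S *m S) => T /matrixP E; apply/matrixP=> i j; move: (E i j).
  rewrite !mxE natrD !natz; move: (T i j) (S i j) => x y.
  case: (i == j); rewrite ?mulr1n ?mulr0n; lia.
pose A : 'M_q := J - 2%:M.
have AT : A^T = A by rewrite linearB /= JT tr_scalar_mx.
have A1 i j : A i j = 1 \/ A i j = -1.
  by rewrite !mxE; case: (i == j); [right|left].
have CD1 e : e = 1 \/ e = -1 ->
    forall i j, (C + e%:M) i j = 1 \/ (C + e%:M) i j = -1.
  move=> e1 i j; rewrite !mxE; case: eqVneq => [<-|ij].
    by rewrite C0 add0r mulr1n.
  by rewrite mulr0n addr0; apply: C1.
have commCJ : comm_mx C J by rewrite /comm_mx CJ JC.
have commCtJ : comm_mx C^T J.
  by rewrite /comm_mx -JT -!trmx_mul CJ JC.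
have trCD e : (C + e%:M)^T = C^T + e%:M by rewrite linearD /= tr_scalar_mx.
have commAC e : comm_mx A (C + e%:M).
  by rewrite /A -raddfN; apply/comm_mx_addscalar/comm_mx_sym.
have commACt e : comm_mx A (C^T + e%:M).
  by rewrite /A -raddfN; apply/comm_mx_addscalar/comm_mx_sym.
pose X := pencil S A (C + 1%:M); pose Y := pencil S (- A) (C + (-1)%:M).
have XT : X^T = pencil S A (- (C^T + 1%:M)) by rewrite pencil_tr // AT trCD.
have YT : Y^T = pencil S (- A) (- (C^T + (-1)%:M)).
  by rewrite pencil_tr // linearN /= AT trCD.
exists (block_mx X Y (- Y^T) X^T); apply: hadamard_of_commuting_pair.
- by apply: pencil_pm1 => //; apply: CD1; left.
- apply: pencil_pm1 => //; last by apply: CD1; right.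
  by move=> i j; rewrite mxE; case: (A1 i j) => ->; [right|left; rewrite opprK].
- apply: (pencil_comm SS) => //.
  + exact/comm_mxN.
  + exact/comm_mxN/comm_mx_sym.
  + exact: comm_mx_addscalar.
- rewrite XT; apply: (pencil_comm SS) => //.
  + exact/comm_mxN.
  + exact/comm_mx_sym.
  + exact/comm_mxN/comm_mx_addscalar.
- rewrite YT; apply: (pencil_comm SS) => //.
  + exact/comm_mxN/comm_mx_sym/comm_mxN/comm_mx_sym.
  + exact/comm_mxN/comm_mx_sym.
  + exact/comm_mxN/comm_mx_addscalar.
(* The scalar target is a pencil with zero [S]-coefficient, so comparing coefficients suffices. *)
rewrite XT YT !(pencil_mul _ _ _ _ SS) pencilD -(pencil_scalar q S).
rewrite !mulmxN !mulNmx !opprK.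
(* [A^2 = (q - 4) J + 4 I], where [q - 4 = s]. *)
have AA : A *m A = (s%:R : int) *: J + 4%:M.
  rewrite /A mulmxBl !mulmxBr JJ -scalar_mxM mul_mx_scalar mul_scalar_mx.
  apply/matrixP=> i j; rewrite !mxE qR.
  by case: (i == j); rewrite ?mulr1n ?mulr0n; ring.
congr pencil.
(* The remaining scalar identity is [8 + 2 s (q + 1) = 2 q (s + 1)], again by [q = s + 4]. *)
- rewrite AA !mulmxDl !mulmxDr CC -!scalar_mxM !mul_mx_scalar !mul_scalar_mx.
  apply/matrixP=> i j; rewrite !mxE.
  move: (J i j) (C i j) (C j i) => x y z.
  rewrite !natrD !natrM natrD qR.
  by case: (i == j); rewrite ?mulr1n ?mulr0n; ring.
(* The products [A C^T] and [C A] cancel between [X] and [Y]; the bare terms in [A] cancel within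
   each. *)
- rewrite !mulmxDr !mulmxDl !mul_mx_scalar !mul_scalar_mx.
  move: (A *m C^T) (C *m A) => D E.
  by apply/matrixP=> i j; rewrite !mxE; ring.
Qed.

End SkewPencils.

Theorem theorem3p4 (s q : nat) (hs : (0 < s)%N) (hq : (0 < q)%N)
    (hsq : (s%:Z = q%:Z - 4%:Z)%R) (hs3 : (s = 3 %[mod 4])%N) :
  (exists H : 'M[int]_(s + 1), skew_hadamard H) ->
  (exists C : 'M[int]_q, conference C) ->
  exists H : 'M[int]_(2 * q * (s + 1)), hadamard H.
Proof.
move=> [H [HH [S [skS defH]]]] [C confC].
have qE : q = s + 4 by lia.
rewrite defH in HH.
have := hadamard_of_skew_conference qE HH skS confC.
by rewrite addnn -mul2n mulnA.
Qed.
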